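(* Let $K: S^1 \to \mathbb{R}^3$ be a smooth knot, and let $x_0 \in K(S^1)$ be a fixed base point. Then for every positive integer $n$ there is a regular $n$-gon inscribing $K$ that contains $x_0$ as a vertex.
   Context: A smooth knot is a smooth embedding $K: S^1 \to \mathbb{R}^3$ (in particular injective with nowhere vanishing derivative). $S^1$ is the unit circle in $\mathbb{C}$ and $\|\cdot\|$ is the Euclidean norm. A regular $n$-gon inscribing $K$ is a sequence of $n$ distinct points $x_0,\dots,x_{n-1}$ lying on the image of $K$ in cyclic order, i.e. $x_i = K(e^{2\pi \sqrt{-1}\, t_i})$ for some real numbers $t_0 < t_1 < \cdots < t_{n-1} < t_0+1$, such that the distances $\|x_{i-1}-x_i\|$, $i=1,\dots,n$, are all the same, where $x_n := x_0$. The points $x_i$ are the vertices of the regular $n$-gon. Only the side lengths are required to be equal (no condition on angles or planarity). *)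

(* Defs.v *)
From HB Require Import structures.
From mathcomp Require Import all_boot all_order all_algebra.
From mathcomp Require Import complex.
From mathcomp Require Import boolp classical_sets reals.
From mathcomp Require Import topology normedtype derive trigo.

Set Implicit Arguments.
Unset Strict Implicit.
Unset Printing Implicit Defensive.

Import Order.TTheory GRing.Theory Num.Theory.
Import numFieldNormedType.Exports.

Local Open Scope classical_set_scope.
Local Open Scope ring_scope.

Definition circle (R : realType) : Type := {z : R[i] | `|z| == 1}.

Lemma norm_cos_sin (R : realType) (a : R) :
  `|(cos a +i* sin a)%C : R[i]| == 1.
Proof. by rewrite normc_def /= cos2Dsin2 sqrtr1. Qed.

(* t |-> exp (2 pi sqrt(-1) t) *)
Definition circle_exp (R : realType) (t : R) : circle R :=
  exist _ (cos (2 * pi * t) +i* sin (2 * pi * t))%C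
    (norm_cos_sin (2 * pi * t)).

(* The norm that the library puts on row vectors is the maximum norm; it is
   only used below through the topology it induces. *)
Definition enorm (R : realType) (d : nat) (v : 'rV[R]_d) : R :=
  Num.sqrt (\sum_(k < d) v ord0 k ^+ 2).

(* As circle_exp is a smooth covering map and a local diffeomorphism, K is
   smooth iff its lift K \o circle_exp is, and the derivative of K vanishes
   nowhere iff that of the lift does.  As the circle is compact, an injective
   immersion of it is an embedding. *)
Record smooth_knot (R : realType) (K : circle R -> 'rV[R]_3) : Prop := {
  knot_smooth : forall (m : nat) (t : R),
    derivable ((K \o @circle_exp R)^`(m))%classic t 1;
  knot_immersion : forall t : R, (K \o @circle_exp R)^`()%classic t != 0;
  knot_injective : injective K
}.

(* Indices of vertices are taken modulo n: ordS i is i + 1, and ordS of the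
   last index is 0.  Only the values t 0, ..., t (n - 1) matter. *)
Record regular_gon_inscribing (R : realType) (K : circle R -> 'rV[R]_3)
    (n : nat) (x : 'I_n -> 'rV[R]_3) : Prop := {
  gon_distinct : injective x;
  gon_cyclic_order : exists t : nat -> R,
    [/\ forall i j : nat, (i < j < n)%N -> t i < t j,
        t n.-1 < t 0%N + 1
      & forall i : 'I_n, x i = K (circle_exp (t i))];
  gon_equilateral : forall i j : 'I_n,
    enorm (x i - x (ordS i)) = enorm (x j - x (ordS j))
}.

(* Main.v *)
(* Let f be the 1-periodic lift of the knot, based at f(a) = x0, and write
   m = n - 1.  A partition of [a, a + 1] into n arcs is a point of an m-simplex;
   attach to each of its arcs c a continuous weight: the squared chord, plus a
   penalty that is positive only if the arc is longer than 1 - e.  The weight of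
   an empty arc vanishes and the weights never all vanish, so an arc of maximal
   weight is nonempty.  By the theorem of Knaster, Kuratowski and Mazurkiewicz
   some partition has all weights equal.  No arc of that partition is longer
   than 1 - e: the other arcs would lie in a short piece of the knot around x0,
   where an immersed curve is almost straight, so that the chord of the long arc
   would be at least that of a neighbouring one, and its weight strictly larger.
   Hence all the chords are equal.

   The KKM theorem is obtained on the cube, which maps onto the simplex, from a
   parity count of rainbow simplices in the Freudenthal triangulation. *)

Require Import Defs.
From mathcomp Require Import all_boot all_order all_algebra.
From mathcomp Require Import complex ring lra zify.
From mathcomp Require Import boolp classical_sets reals interval_inference.
From mathcomp Require Import topology normedtype derive trigo.

Set Implicit Arguments.
Unset Strict Implicit.
Unset Printing Implicit Defensive.

(** * Sums modulo two *)

(** Every orbit of [h] on which [F] holds has two elements, so their contributions cancel; [lo]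
    picks the one of smaller rank. *)
Lemma addb_involution (T : finType) (P F : pred T) (h : T -> T) :
    involutive h -> (forall u, P (h u) = P u) ->
    (forall u, P u -> F (h u) = F u) ->
    (forall u, P u -> F u -> h u != u) ->
  \big[addb/false]_(u | P u) F u = false.
Proof.
move=> hK Ph Fh fixF.
pose lo u := enum_rank u < enum_rank (h u).
rewrite (bigID lo) /= [X in _ (+) X](bigID (fun u => h u == u)) /=.
rewrite [X in _ (+) (X (+) _)]big1 ?addFb; last first.
  move=> u /andP[/andP[Pu _] hu]; apply/negP => Fu.
  by move: (fixF u Pu Fu); rewrite hu.
rewrite [X in _ (+) X](reindex_inj (inv_inj hK)) /=.
rewrite [X in _ (+) X](eq_big (fun u => P u && lo u) F) ?addbb //.
  move=> u; rewrite Ph /lo hK -leqNgt -andbA; congr (_ && _).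
  rewrite ltn_neqAle andbC; congr (_ && _).
  congr negb; by apply/eqP/eqP => [<- //|e]; apply/enum_rank_inj/val_inj.
by move=> u /andP[/andP[Pu _] _]; rewrite Ph in Pu; rewrite Fh.
Qed.

(** * Kuhn's cubical Sperner lemma *)

Definition rainbow (k : nat) (w : seq nat) := perm_eq w (iota 0 k.+1).

(** Labels of the facet opposite vertex [j] in a simplex with k + 2 vertices. *)
Definition facet (k j : nat) (f : nat -> nat) :=
  [seq f i | i <- iota 0 k.+2 & i != j].

Lemma perm_facet k j (f : nat -> nat) : j < k.+2 ->
  perm_eq [seq f i | i <- iota 0 k.+2] (f j :: facet k j f).
Proof.
move=> jk; rewrite -(map_cons f); apply: perm_map.
rewrite -[X in j :: X](rem_filter j (iota_uniq 0 k.+2)).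
by apply: perm_to_rem; rewrite mem_iota.
Qed.

(** A rainbow simplex has one rainbow facet, opposite the label k + 1. Any other simplex with a
    rainbow facet repeats exactly one label, and its rainbow facets are the two opposite the
    vertices carrying it. *)
Lemma rainbow_facets k (f : nat -> nat) : (forall i, i < k.+2 -> f i <= k.+1) ->
  rainbow k.+1 [seq f i | i <- iota 0 k.+2] =
  \big[addb/false]_(j < k.+2) rainbow k (facet k j f).
Proof.
move=> fle; set w := map _ _.
have iotaS : iota 0 k.+2 = rcons (iota 0 k.+1) k.+1.
  by rewrite -cats1 -[k.+2]addn1 iotaD.
have consE : perm_eq (k.+1 :: iota 0 k.+1) (iota 0 k.+2).
  by rewrite iotaS perm_sym perm_rcons.
case: (boolP [exists j : 'I_k.+2, rainbow k (facet k j f)]); last first.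
  move=> /existsPn none; rewrite big1; last by move=> j _; apply/negbTE.
  apply/negP => rw.
  have: k.+1 \in w by rewrite (perm_mem rw) mem_iota leqnn.
  case/mapP => j; rewrite mem_iota add0n => /andP[_ jk] fj.
  move/negP: (none (Ordinal jk)); apply => /=.
  rewrite /rainbow -(perm_cons k.+1) {1}fj (permPr consE).
  apply: perm_trans rw; rewrite perm_sym; exact: perm_facet.
case/existsP => j rj.
have wj : perm_eq w (f j :: iota 0 k.+1).
  apply: perm_trans (perm_facet f (ltn_ord j)) _.
  by rewrite perm_cons.
(* Given the rainbow facet [j], facet [i] is rainbow iff the omitted labels agree; one direction
   compares the sums of all labels. *)
rewrite (eq_bigr (fun i : 'I__ => f i == f j)); last first.
  move=> i _; apply/idP/eqP => [ri|e].
    have : perm_eq (f i :: iota 0 k.+1) (f j :: iota 0 k.+1).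
      apply: perm_trans wj; rewrite perm_sym.
      apply: perm_trans (perm_facet f (ltn_ord i)) _.
      by rewrite perm_cons.
    move/perm_sumn; rewrite /= => /eqP; rewrite eqn_add2r; by move/eqP.
  have := perm_facet f (ltn_ord i); rewrite perm_sym => /perm_trans/(_ wj).
  by rewrite e perm_cons.
have -> : \big[addb/false]_(i < k.+2) (f i == f j) = odd (count_mem (f j) w).
  rewrite -sum1_count big_map (big_morph odd oddD (erefl _)) [RHS]big_mkcond.
  rewrite -[iota 0 k.+2]/(index_iota 0 k.+2) big_mkord.
  by apply: eq_bigr => i _ /=; case: eqP.
rewrite (permP wj) -cat1s count_cat (count_uniq_mem _ (iota_uniq 0 k.+1)).
rewrite mem_iota.
rewrite (_ : count _ _ = 1) ?oddD ?oddb; last by rewrite /= eqxx.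
rewrite /rainbow (permPl wj) -(permPr consE) ltnS leq0n andTb.
have := fle j (ltn_ord j); case: (leqP (f j) k) => [le _|gt le].
  apply/negP => /perm_sumn /= /eqP; rewrite eqn_add2r => /eqP e; lia.
have -> : f j = k.+1 by lia.
exact: perm_refl.
Qed.

Lemma uniq_map_inj (T T' : eqType) (f : T -> T') s x y :
  uniq (map f s) -> x \in s -> y \in s -> f x = f y -> x = y.
Proof.
elim: s => //= a s IH /andP[na us]; rewrite !inE.
by move=> /predU1P[->|xs] /predU1P[->|ys] // e;
  [move: na; rewrite e map_f|move: na; rewrite -e map_f|exact: IH].
Qed.

Section Kuhn.

Variables (m N : nat) (lab : {ffun 'I_m -> nat} -> nat).
Let L := m.+1 * N.
Let V := {ffun 'I_m -> 'I_L.+1}.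

(* For u in the cube [0, L)^m, the points vtx u 0, ..., vtx u m span a possibly
   degenerate Freudenthal simplex: each coordinate increases by one at the step
   given by the residue of u_j modulo m.+1.  Degenerate simplices are never
   rainbow, so they need not be excluded. *)
Definition vtx (u : V) (i : nat) : {ffun 'I_m -> nat} :=
  [ffun j => (u j + i) %/ m.+1].

(* Indexes the simplices of the face x_k = ... = x_(m-1) = N. *)
Definition box (k : nat) : pred V := fun u => [forall j, (u j < L) == (j < k)].

Definition in_grid (x : {ffun 'I_m -> nat}) := [forall j, x j <= N].

Hypothesis lab_le : forall x, in_grid x -> lab x <= m.
Hypothesis lab_top : forall x j, in_grid x -> x j = N -> lab x != j.+1.
Hypothesis lab_bot : forall x j, in_grid x -> x j = 0 -> j < lab x.

Lemma vtx_in_grid u i : i <= m -> in_grid (vtx u i).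
Proof.
move=> im; apply/forallP => j; rewrite ffunE -ltnS ltn_divLR //.
by have := ltn_ord (u j); rewrite /L; lia.
Qed.

(** A label c > k is excluded by [lab_top], since the coordinate c - 1 equals N on this face. *)
Lemma box_lab k u i : k <= m -> i <= m -> box k u -> lab (vtx u i) <= k.
Proof.
move=> km im /forallP bu; rewrite leqNgt; apply/negP => lt.
have cu := vtx_in_grid u im.
have lm := lab_le cu.
have jm : (lab (vtx u i)).-1 < m by lia.
have := bu (Ordinal jm); rewrite /= => /eqP uL.
have uE : u (Ordinal jm) = L :> nat.
  by have := ltn_ord (u (Ordinal jm)); lia.
have vN : vtx u i (Ordinal jm) = N.
  by rewrite ffunE uE /L mulnC divnMDl // divn_small ?addn0.
by move/eqP: (lab_top cu vN) => /=; lia.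
Qed.

Lemma divn_small_add q r i : r < m.+1 -> i < m.+1 ->
  (q * m.+1 + r + i) %/ m.+1 = q + (m.+1 <= r + i).
Proof.
move=> rm im; rewrite -addnA divnMDl //; congr (_ + _).
case: (ltnP m (r + i)) => [le|lt]; last by rewrite divn_small.
by rewrite -(subnKC le) -{1}[m.+1]mul1n divnMDl // divn_small ?addn0 //; lia.
Qed.

(* Exchanges the two residues modulo m.+1 for which a coordinate jumps between
   the vertices k.-1 and k, respectively k and k.+1. *)
Definition swap (k a : nat) : nat :=
  if a %% m.+1 + k == m.+1 then a.-1
  else if a %% m.+1 + k == m then a.+1 else a.

Lemma swap_block k q r : 0 < k < m -> r < m.+1 ->
  exists2 r', r' < m.+1 & swap k (q * m.+1 + r) = q * m.+1 + r' /\
    r' = if r + k == m.+1 then r.-1 else if r + k == m then r.+1 else r.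
Proof.
move=> km rm; rewrite /swap modnMDl modn_small //.
exists (if r + k == m.+1 then r.-1 else if r + k == m then r.+1 else r).
  by do 2?[case: eqP => ?]; lia.
by split=> //; do 2?[case: eqP => ?]; lia.
Qed.

Lemma swapK k : 0 < k < m -> involutive (swap k).
Proof.
move=> km a; rewrite (divn_eq a m.+1); set q := a %/ _; set r := a %% _.
have rm : r < m.+1 by rewrite ltn_mod.
have [r' rm' [-> E]] := swap_block q km rm.
have [r'' _ [-> E']] := swap_block q km rm'.
by congr (_ + _); rewrite E'; move: E; do 4?[case: eqP => ?]; lia.
Qed.

Lemma swap_ltL k a : 0 < k < m -> (swap k a < L) = (a < L).
Proof.
move=> km; rewrite (divn_eq a m.+1); set q := a %/ _; set r := a %% _.
have rm : r < m.+1 by rewrite ltn_mod.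
have [r' rm' [-> _]] := swap_block q km rm.
by rewrite /L ![m.+1 * N]mulnC -!ltn_divLR // !divnMDl // !divn_small.
Qed.

Lemma swap_L k : 0 < k < m -> swap k L = L.
Proof. move=> km; rewrite /swap /L mulnC modnMl add0n; do 2?[case: eqP => ?];
  lia. Qed.

Lemma swap_vtx k a i : 0 < k < m -> i <= m -> i <> k ->
  (swap k a + i) %/ m.+1 = (a + i) %/ m.+1.
Proof.
move=> km im ik; rewrite (divn_eq a m.+1); set q := a %/ _; set r := a %% _.
have rm : r < m.+1 by rewrite ltn_mod.
have [r' rm' [-> E]] := swap_block q km rm.
rewrite !divn_small_add //; congr (_ + nat_of_bool _); rewrite E.
by do 2?[case: eqP => ?]; lia.
Qed.

(** A fixed coordinate does not jump between vertices k - 1 and k + 1. If all coordinates are fixed,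
    these vertices coincide and a facet containing both repeats a label. *)
Lemma swap_fixed k a : 0 < k < m -> swap k a = a ->
  (a + k.-1) %/ m.+1 = (a + k.+1) %/ m.+1.
Proof.
move=> km; rewrite (divn_eq a m.+1); set q := a %/ _; set r := a %% _.
have rm : r < m.+1 by rewrite ltn_mod.
have [r' rm' [-> E]] := swap_block q km rm => /addnI.
rewrite !divn_small_add; try lia; move=> e; congr (_ + nat_of_bool _).
by move: E; rewrite e; do 2?[case: eqP => ?]; lia.
Qed.

Definition swapV (k : nat) (u : V) : V := [ffun j => inord (swap k (u j))].

Lemma swapVE k u j : 0 < k < m -> swapV k u j = swap k (u j) :> nat.
Proof.
move=> km; rewrite ffunE inordK // ltnS leq_eqVlt swap_ltL //.
case: (ltnP (u j) L) => [_|ge]; first by rewrite orbT.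
have -> : u j = L :> nat by have := ltn_ord (u j); lia.
by rewrite swap_L ?eqxx.
Qed.

(* The swap is an involution on the simplices sharing the j-th facet. *)
Lemma interior_facet k j : k.+1 <= m -> 0 < j < k.+1 ->
  \big[addb/false]_(u | box k.+1 u)
    rainbow k (facet k j (fun i => lab (vtx u i))) = false.
Proof.
move=> km jk; have jm : 0 < j < m by lia.
apply: (addb_involution (h := swapV j)).
- by move=> u; apply/ffunP => c; apply: ord_inj; rewrite !(swapVE _ _ jm) swapK.
- by move=> u; apply: eq_forallb => c; rewrite (swapVE _ _ jm) swap_ltL.
- move=> u _; congr (rainbow _ _); apply/eq_in_map => i.
  rewrite mem_filter mem_iota => /andP[/eqP ij ik]; congr lab.
  by apply/ffunP => c; rewrite [LHS]ffunE [RHS]ffunE swapVE // swap_vtx //; lia.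
move=> u _ rb; apply/eqP => e.
have ve : vtx u j.-1 = vtx u j.+1.
  apply/ffunP => c; rewrite !ffunE; apply: swap_fixed => //.
  by rewrite -swapVE // e.
have un : uniq (facet k j (fun i => lab (vtx u i))).
  by rewrite (perm_uniq rb) iota_uniq.
have : j.-1 = j.+1; last by lia.
by apply: (uniq_map_inj un); rewrite ?mem_filter ?mem_iota ?ve //; lia.
Qed.

Definition rainbow_face (k : nat) (u : V) :=
  rainbow k [seq lab (vtx u i) | i <- iota 0 k.+1].

Lemma face_label k u c : rainbow_face k u -> c <= k ->
  exists2 i, i <= k & lab (vtx u i) = c.
Proof.
move=> fu ck; have : c \in [seq lab (vtx u i) | i <- iota 0 k.+1].
  by rewrite (perm_mem fu) mem_iota.
by case/mapP => i; rewrite mem_iota => ik ->; exists i => //; lia.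
Qed.

(** The label j + 1 occurs on the simplex, but [lab_top] forbids it where the coordinate j is N. *)
Lemma face_neqL k u (j : 'I_m) :
  k <= m -> j < k -> rainbow_face k u -> u j <> L :> nat.
Proof.
move=> km jk fu uL; have [i ik labi] := face_label fu jk.
have im : i <= m by lia.
have := lab_top (vtx_in_grid u im) (j := j); rewrite labi eqxx => H.
suff /H : vtx u i j = N by [].
by rewrite ffunE uL /L mulnC divnMDl // divn_small ?addn0.
Qed.

Lemma face_neq0 k u (j : 'I_m) : k <= m -> rainbow_face k u -> u j <> 0 :> nat.
Proof.
move=> km fu u0; have [i ik labi] := face_label fu (leq0n k).
have im : i <= m by lia.
have := lab_bot (vtx_in_grid u im) (j := j); rewrite labi ltn0 => H.
suff /H : vtx u i j = 0 by [].
by rewrite ffunE u0 divn_small.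
Qed.

(** On [box k] this renumbers vertices: vertex i of the image is vertex i + 1 of [u] when i < m. The
    cap at [L] has no effect there. *)
Definition shift_up (k : nat) (u : V) : V :=
  [ffun j : 'I_m => if j < k then inord (minn L (u j).+1) else u j].

Definition shift_down (k : nat) (u : V) : V :=
  [ffun j : 'I_m => if j < k then inord (u j).-1 else u j].

Lemma shift_upE k u j :
  shift_up k u j = (if j < k then minn L (u j).+1 else u j) :> nat.
Proof. by rewrite ffunE; case: ifP => // _; rewrite inordK //; lia. Qed.

Lemma shift_downE k u j :
  shift_down k u j = (if j < k then (u j).-1 else u j) :> nat.
Proof.
by rewrite ffunE; case: ifP => // _; rewrite inordK //; have := ltn_ord (u j);
  lia.
Qed.

(** The image of [box k] under [shift_up k]. *)
Definition upper_box (k : nat) : pred V :=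
  fun u => [forall j : 'I_m, if j < k then 0 < u j else u j == L :> nat].

Hypothesis N_gt0 : 0 < N.

Lemma boxP k (u : V) : reflect (forall j : 'I_m,
  [/\ j < k & u j < L] \/ [/\ k <= j & u j = L :> nat]) (box k u).
Proof.
apply: (iffP forallP) => H j; have := ltn_ord (u j); have := H j.
  by case: (ltnP j k) => jk /eqP uj uL; [left|right]; split; lia.
by case=> [[jk uj]|[jk uj]] _; apply/eqP; lia.
Qed.

Lemma upper_boxP k (u : V) : reflect (forall j : 'I_m,
  [/\ j < k & 0 < u j] \/ [/\ k <= j & u j = L :> nat]) (upper_box k u).
Proof.
apply: (iffP forallP) => H j; have := H j.
  by case: (ltnP j k) => jk uj; [left|right]; split=> //; apply/eqP.
by case=> [[-> //]|[jk ->]]; rewrite ltnNge jk /= eqxx.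
Qed.

(* Dropping vertex 0 of u amounts to dropping the last vertex of u + 1. *)
Lemma sum_upper_box k : k <= m ->
  \big[addb/false]_(u | box k.+1 u) rainbow_face k (shift_up k.+1 u) =
  \big[addb/false]_(u | upper_box k.+1 u) rainbow_face k u.
Proof.
move=> km; have L_gt0 : 0 < L by rewrite /L; lia.
rewrite [RHS](reindex_onto (shift_up k.+1) (shift_down k.+1)) /=.
  apply: eq_bigl => u; apply/boxP/andP => [bu|[/upper_boxP ub /eqP us] j].
    split; first apply/upper_boxP => j.
      by rewrite shift_upE; case: (bu j) => -[jk uj]; case: (ltnP j k.+1); lia.
    apply/eqP/ffunP => j; apply: ord_inj; rewrite shift_downE shift_upE.
    case: (bu j) => -[jk uj]; first by rewrite jk (minn_idPr uj).
    by rewrite ltnNge jk.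
  have := ub j; have := ltn_ord (u j); rewrite shift_upE.
  have := congr1 (fun v : V => v j : nat) us => /=;
    rewrite shift_downE shift_upE.
  by case: (ltnP j k.+1) => jk us' uL [[j1 u1]|[j1 u1]]; [left|lia|lia|right];
    split; lia.
move=> u /upper_boxP ub; apply/ffunP => j; apply: ord_inj.
rewrite shift_upE shift_downE; case: (ub j) (ltn_ord (u j)) => -[jk uj].
  by rewrite jk prednK // ltnS => uL; apply/minn_idPr.
by move=> _; rewrite ltnNge jk.
Qed.

Lemma big_addb_condE (P F : pred V) :
  \big[addb/false]_(u | P u) F u = \big[addb/false]_(u | P u && F u) true.
Proof.
rewrite big_mkcond [RHS]big_mkcond; apply: eq_bigr => u _.
by case: (P u) (F u) => [] [].
Qed.

(** Simplices common to both boxes cancel. Those only in [box k.+1] are not rainbow by [face_neq0];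
    by [face_neqL], a rainbow one only in [upper_box k.+1] has its coordinate k equal to [L], so it
    lies in [box k]. *)
Lemma boundary_facets k : k < m ->
  \big[addb/false]_(u | upper_box k.+1 u) rainbow_face k u (+)
  \big[addb/false]_(u | box k.+1 u) rainbow_face k u =
  \big[addb/false]_(u | box k u) rainbow_face k u.
Proof.
move=> km; have L_gt0 : 0 < L by rewrite /L; lia.
rewrite (bigID (box k.+1)) /= [X in _ (+) X](bigID (upper_box k.+1)) /=.
rewrite (eq_bigl (fun u => box k.+1 u && upper_box k.+1 u)); last first.
  by move=> u; rewrite andbC.
rewrite [X in _ (+) (_ (+) X)]big1 => [|u /andP[/boxP bu nub]]; last first.
  apply/negP => fu; case/negP: nub; apply/upper_boxP => j.
  have := face_neq0 (j := j) (ltnW km) fu.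
  by case: (bu j) => -[jk uj] u0; [left|right]; split; lia.
rewrite addbF addbC addKb big_addb_condE [RHS]big_addb_condE.
apply: eq_bigl => u;
  apply/andP/andP => [[/andP[/upper_boxP ub nb] fu]|[/boxP bu fu]].
  split=> //; apply/boxP => j.
  have neqL (i : 'I_m) : i < k -> u i < L.
    move=> ik; rewrite ltn_neqAle -ltnS ltn_ord andbT;
      exact/eqP/(face_neqL (ltnW km) ik fu).
  case: (ltnP j k) => jk; first by left; split=> //; exact: neqL.
  right; split=> //; case: (ub j) => -[jk' uj] //.
  have := ltn_ord (u j); rewrite ltnS leq_eqVlt => /predU1P[//|ult].
  case/negP: nb; apply/boxP => i; case: (ub i) => -[ik ui]; last by right.
  left; split=> //; case: (ltnP i k) => ik'; first exact: neqL.
  by have -> : i = j by apply: ord_inj; lia.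
split=> //; apply/andP; split.
  apply/upper_boxP => j; have := face_neq0 (j := j) (ltnW km) fu => u0.
  case: (bu j) => -[jk uj]; first by left; split; lia.
  by case: (ltnP j k.+1) => jk'; [left|right]; split; lia.
apply/negP => /boxP/(_ (Ordinal km)); case: (bu (Ordinal km)) => /=; lia.
Qed.

Definition count_simplices k := \big[addb/false]_(u | box k u) rainbow_face k u.

(** Double counting: rainbow simplices are counted through their rainbow facets. The interior facets
    cancel, and the first and last ones leave only the boundary face x_k = N. *)
Lemma count_simplicesS k : k < m -> count_simplices k.+1 = count_simplices k.
Proof.
move=> km;
  rewrite /count_simplices -[RHS]boundary_facets //
    -[X in _ = X (+) _]sum_upper_box; last by lia.
under eq_bigr => u bu.
  rewrite /rainbow_face rainbow_facets; last first.
    move=> i ik; apply: box_lab => //; lia.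
  over.
rewrite exchange_big /= big_ord_recl big_ord_recr /=.
rewrite [X in _ (+) (X (+) _)]big1 ?addFb; last first.
  by move=> j _; apply: interior_facet => //=; rewrite /bump;
    have := ltn_ord j; lia.
congr (_ (+) _).
  apply: eq_bigr => u /boxP bu; congr (rainbow _ _).
  rewrite /facet (_ : [seq i <- iota 0 k.+2 | i != 0] = map S (iota 0 k.+1));
    last first.
    rewrite -[map S _](iotaDl 1 0) addn0.
    rewrite -[LHS]/[seq i <- iota 1 k.+1 | i != 0];
      apply/all_filterP/allP => i; rewrite mem_iota; lia.
  rewrite -map_comp; apply/eq_in_map => i; rewrite mem_iota => ik /=.
  congr lab; apply/ffunP => j; rewrite [LHS]ffunE [RHS]ffunE shift_upE.
  case: (bu j) => -[jk uj]; first by rewrite jk; congr (_ %/ _); lia.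
  rewrite ltnNge jk uj /L [m.+1 * N]mulnC !divnMDl // !divn_small //; lia.
apply: eq_bigr => u bu; congr (rainbow _ (map _ _)).
rewrite -[k.+2]addn1 iotaD filter_cat [bump _ _]add1n /= eqxx cats0.
rewrite -[RHS]/(iota 0 k.+1) -[LHS]/[seq i <- iota 0 k.+1 | i != k.+1].
apply/all_filterP/allP => i; rewrite mem_iota; lia.
Qed.

(** The only simplex is the corner (N, ..., N), which must have label 0. *)
Lemma count_simplices0 : count_simplices 0.
Proof.
rewrite /count_simplices (big_pred1 [ffun=> ord_max]).
  rewrite /rainbow_face /= /rainbow.
  suff : lab (vtx [ffun=> ord_max] 0) <= 0 by case: (lab _).
  apply: box_lab => //; apply/boxP => j; right; split=> //.
  by rewrite ffunE.
move=> u; apply/boxP/eqP => [bu|-> j]; last by right; rewrite ffunE.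
apply/ffunP => j; apply: ord_inj; rewrite ffunE.
by case: (bu j) => -[].
Qed.

Lemma kuhn_lemma : exists q : 'I_m -> nat, (forall j, q j < N) /\
  forall c, c <= m -> exists x : {ffun 'I_m -> nat},
    lab x = c /\ forall j, q j <= x j <= (q j).+1.
Proof.
have : count_simplices m.
  suff H k : k <= m -> count_simplices k by exact: H.
  by elim: k => [_|k IH km];
    [exact: count_simplices0|rewrite count_simplicesS // IH; lia].
rewrite /count_simplices.
case: (pickP (fun u => box m u && rainbow_face m u)) =>
  [u /andP[bu fu] _|none]; last first.
  rewrite big1 // => u bu; by have := none u; rewrite bu.
(* Lower corner of a unit cube containing the whole simplex. *)
exists (fun j => u j %/ m.+1); split => [j|c cm].
  rewrite ltn_divLR // mulnC; by move/forallP/(_ j): bu;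
    rewrite ltn_ord => /eqP.
have [i ik <-] := face_label fu cm; exists (vtx u i); split=> // j.
rewrite ffunE {2 3}(divn_eq (u j) m.+1) divn_small_add ?ltn_mod //.
by case: leqP => _ /=; lia.
Qed.

End Kuhn.

Import Order.TTheory GRing.Theory Num.Theory.
Import numFieldNormedType.Exports.

Local Open Scope classical_set_scope.
Local Open Scope ring_scope.

(** * A covering theorem on the cube *)

Section KKM.
Variables (R : realType) (m : nat) (g : 'I_m.+1 -> 'rV[R]_m -> R).

Definition unit_cube : set 'rV[R]_m := [set u | forall j, 0 <= u ord0 j <= 1].

(** For fixed [c] these points form one set of the KKM cover; at a point common to all the sets the
    functions [g c] agree. *)
Definition maximal_at (u : 'rV[R]_m) (c : 'I_m.+1) :=
  forall c', g c' u <= g c u.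

Hypothesis g_continuous : forall c, continuous (g c).
Hypothesis g_top : forall u c (j : 'I_m), unit_cube u -> maximal_at u c ->
  u ord0 j = 1 -> c != j.+1 :> nat.
Hypothesis g_bot : forall u c (j : 'I_m), unit_cube u -> maximal_at u c ->
  u ord0 j = 0 -> (j < c)%N.

(** Kuhn's lemma on the grid of mesh 1 / (k + 1), each grid point being labelled by an index of
    largest value. *)
Lemma approximate_coincidence (k : nat) : exists y : 'rV[R]_m, unit_cube y /\
  forall c, exists z : 'rV[R]_m,
    (forall j, `|y ord0 j - z ord0 j| <= k.+1%:R^-1) /\ maximal_at z c.
Proof.
pose pt (x : {ffun 'I_m -> nat}) : 'rV[R]_m := \row_j ((x j)%:R / k.+1%:R).
pose lab x : 'I_m.+1 := [arg max_(c > ord0) g c (pt x)]%O.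
have labP x : maximal_at (pt x) (lab x).
  by rewrite /lab; case: arg_maxP => // c _ H c'; apply: H.
have k0 : (0 : R) < k.+1%:R by rewrite ltr0n.
have ptP x : in_grid k.+1 x -> unit_cube (pt x).
  move=> /forallP xN j /=; rewrite !mxE divr_ge0 ?ler0n //=.
  by rewrite ler_pdivrMr // mul1r ler_nat.
have := @kuhn_lemma m k.+1 (fun x => lab x) _ _ _ isT; case.
- by move=> x _; rewrite -ltnS.
- move=> x j xN xj; apply: (g_top (ptP _ xN) (labP x)).
  by rewrite mxE xj divff // gt_eqF.
- move=> x j xN xj; apply: (g_bot (ptP _ xN) (labP x)).
  by rewrite mxE xj mul0r.
move=> q [qN qP]; exists (pt [ffun j => q j]); split.
  by apply: ptP; apply/forallP => j; rewrite ffunE ltnW.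
move=> c; have [x [xc xq]] := qP c (leq_ord c); exists (pt x); split.
  move=> j;
    rewrite !mxE ffunE -mulrBl normrM [X in _ * X]gtr0_norm ?invr_gt0 //.
  rewrite ler_pdivrMr // mulVf ?gt_eqF //.
  have /andP[le1 le2] := xq j; rewrite distrC ger0_norm ?subr_ge0 ?ler_nat //.
  by rewrite lerBlDr nat1r ler_nat.
have -> : c = lab x by apply: val_inj.
exact: labP.
Qed.

Lemma gap_continuous c' c : continuous (fun v => g c' v - g c v).
Proof. move=> v; apply: (@cvgB _ _ _ (nbhs v) (nbhs_filter v));
  exact: g_continuous. Qed.

(** At a cluster point [u] of the approximations, [g c u < g c' u] would persist on a ball, which
    contains a point where [c] is maximal. *)
Lemma coincidence : exists2 u, unit_cube u & forall c c', g c u = g c' u.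
Proof.
have [y yP] := choice approximate_coincidence.
have cpt : compact unit_cube.
  rewrite (_ : unit_cube = [set u :
    'rV[R]_m | forall j, `[0, 1]%classic (u ord0 j)]).
    by apply: (@rV_compact R m (fun=> `[0, 1]%classic)) => _;
      apply: segment_compact.
  by apply/seteqP; split=> u cu j; have := cu j; rewrite /= in_itv.
have [|u [cu clu]] := cpt (y @ \oo) _.
  by exists 0%N => // k _; case: (yP k).
exists u => //.
suff H c c' : g c' u <= g c u by move=> c c'; apply/eqP; rewrite eq_le !H.
rewrite leNgt; apply/negP => lt.
have : \forall v \near u, 0 < g c' v - g c v.
  by apply: (@cvgr_gt _ _ (nbhs (u :
    'rV[R]_m)) _ _ _ (@gap_continuous c' c u) 0); rewrite subr_gt0.
move=> /nbhs_ballP[e /= e0 eP].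
have e20 : 0 < e / 2 by rewrite divr_gt0.
have [v [[k kE <-] bk]] :
  (y @` [set k | k.+1%:R^-1 < e / 2]) `&` ball u (e / 2) !=set0.
  apply: clu; last exact: nbhsx_ballx.
  have := near_infty_natSinv_lt (PosNum e20).
  by apply: filterS => k ke; exists k.
have [z [zy zmax]] := (yP k).2 c.
have : 0 < g c' z - g c z; last by rewrite subr_gt0 ltNge zmax.
(* One half of [e] covers the distance from [u] to [y k], the other that from [y k] to [z]; balls of
   row vectors are entrywise. *)
apply: eP; rewrite (splitr e); apply: ball_triangle bk _; split=> // i j.
rewrite ord1; exact: le_lt_trans (zy j) _.
Qed.
End KKM.

(** * Partitions of the unit interval *)

Section EqualArcs.
Variables (R : realType) (D : R -> R -> R) (a e : R).
Hypothesis D_continuous : continuous (fun z : R * R => D z.1 z.2).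
Hypothesis D_refl : forall x, D x x = 0.
Hypothesis D_ge0 : forall x y, 0 <= D x y.
Hypothesis D_gt0 : forall x y, x < y < x + 1 -> 0 < D x y.
Hypothesis D_sym : forall x y, D x y = D y x.
Hypothesis D_periodic : forall x y, D x (y + 1) = D x y.
Hypothesis e_gt0 : 0 < e.
Hypothesis e_lehalf : e <= 1 / 2.
Hypothesis D_local : forall p q r s, a - e < p -> p <= q -> q <= r -> r <= s ->
  s < a + e -> D q r <= D p s.

(* Division points of [0, 1] with u_c = tau_(c+1) / tau_(c+2); this maps the
   cube onto the simplex of partitions 0 <= tau_1 <= ... <= tau_m <= 1. *)
Definition tau (m : nat) (u : 'rV[R]_m) (c : nat) : R :=
  if c is c'.+1 then \prod_(i < m | (c' <= i)%N) u ord0 i else 0.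

Definition gap m (u : 'rV[R]_m) c := tau u c.+1 - tau u c.

(* The second term keeps the weights from vanishing simultaneously at the
   partitions with a single arc of positive length. *)
Definition weight m (c : nat) (u : 'rV[R]_m) : R :=
  D (a + tau u c) (a + tau u c.+1) + Num.max 0 (gap u c - (1 - e)).

Lemma tau_continuous m c : continuous (fun u : 'rV[R]_m => tau u c).
Proof.
case: c => [|c] /=; first exact: cst_continuous.
apply: continuous_big => [|i _]; first by move=> z; apply: cvgM;
  [exact: cvg_fst|exact: cvg_snd].
exact: coord_continuous.
Qed.

Lemma weight_continuous m c : continuous (fun u : 'rV[R]_m => weight c u).
Proof.
move=> u; have tc k : (fun v => tau v k) @ nbhs u --> tau u k.
  exact: tau_continuous.
apply: (@cvgD _ _ _ (nbhs u) (nbhs_filter u)).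
  apply: continuous2_cvg.
  - exact: (@D_continuous (_, _)).
  - by apply: cvgD; [exact: cvg_cst|exact: tc].
  - by apply: cvgD; [exact: cvg_cst|exact: tc].
apply: (@continuous_max _ _ (fun=> 0) (fun v => gap v c - (1 - e))).
  exact: cst_continuous.
apply: (@cvgB _ _ _ (nbhs u) (nbhs_filter u)); last exact: cvg_cst.
by apply: (@cvgB _ _ _ (nbhs u) (nbhs_filter u)); exact: tc.
Qed.

Lemma tau_last m (u : 'rV[R]_m) : tau u m.+1 = 1.
Proof. by rewrite /= big_pred0 // => i; rewrite leqNgt ltn_ord. Qed.

Lemma tau_step m (u : 'rV[R]_m) (j : 'I_m) : tau u j.+1 = u ord0 j * tau u j.+2.
Proof.
rewrite /= (bigD1 j) //=; congr (_ * _); apply: eq_bigl => i.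
by rewrite -(inj_eq val_inj) /=; lia.
Qed.

Lemma tau_ge0 m (u : 'rV[R]_m) c : unit_cube u -> 0 <= tau u c.
Proof.
by case: c => // c cu; apply: prodr_ge0 => i _; case/andP: (cu i).
Qed.

Lemma tau_le1 m (u : 'rV[R]_m) c : unit_cube u -> tau u c <= 1.
Proof. by case: c => [|c] cu //=; apply: prodr_ile1 => i _; exact: cu. Qed.

Arguments tau : simpl never.

Lemma gap_ge0 m (u : 'rV[R]_m) (c : 'I_m.+1) : unit_cube u -> 0 <= gap u c.
Proof.
move=> cu; rewrite /gap; case: c => [[|c] cm]; first by rewrite subr0 tau_ge0.
rewrite /= (tau_step u (Ordinal (cm : c < m)%N)).
rewrite -{1}[tau u c.+2]mul1r -mulrBl mulr_ge0 ?tau_ge0 // subr_ge0.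
by case/andP: (cu (Ordinal (cm : c < m)%N)).
Qed.

Lemma sum_gap m (u : 'rV[R]_m) : \sum_(c < m.+1) gap u c = 1.
Proof.
rewrite -(big_mkord xpredT (gap u)) /gap telescope_sumr // tau_last.
by rewrite subr0.
Qed.

Lemma gap_le1 m (u : 'rV[R]_m) (c d : 'I_m.+1) : unit_cube u ->
  c != d -> gap u c + gap u d <= 1.
Proof.
move=> cu cd; rewrite -(sum_gap u) (bigD1 c) // (bigD1 d) 1?eq_sym //=.
by rewrite addrA lerDl sumr_ge0 // => i _; exact: gap_ge0.
Qed.

Lemma gap0_weight m (u : 'rV[R]_m) c : gap u c = 0 -> weight c u = 0.
Proof.
move=> g0; rewrite /weight g0.
have -> : tau u c.+1 = tau u c by apply/eqP; rewrite -subr_eq0; apply/eqP.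
rewrite D_refl add0r; apply/max_idPl. have := e_lehalf; lra.
Qed.

(** An arc shorter than a period has a nonzero chord; for a full period the penalty is [e]. *)
Lemma weight_gt0 m (u : 'rV[R]_m) (c : 'I_m.+1) : unit_cube u ->
  0 < gap u c -> 0 < weight c u.
Proof.
move=> cu g0; rewrite /weight.
have gle1 : gap u c <= 1.
  rewrite -(sum_gap u) (bigD1 c) //= lerDl sumr_ge0 // => i _; exact: gap_ge0.
have [g1|g1] := ltP (gap u c) 1.
  apply: ltr_wpDr; first by rewrite le_max lexx.
  by move: g0 g1; rewrite /gap => g0 g1; apply: D_gt0; apply/andP; split; lra.
by apply: ltr_wpDl; rewrite ?D_ge0 // lt_max; apply/orP; right; have := e_gt0;
  lra.
Qed.

(** The lengths sum to 1, so some arc is nonempty and has positive weight, while an empty arc has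
    weight 0. *)
Lemma maximal_gap_gt0 m (u : 'rV[R]_m) (c : 'I_m.+1) : unit_cube u ->
  maximal_at (fun c : 'I_m.+1 => weight c) u c -> 0 < gap u c.
Proof.
move=> cu cmax; rewrite lt_def gap_ge0 // andbT; apply/eqP => g0.
have le0 (d : 'I_m.+1) : gap u d <= 0.
  rewrite leNgt; apply/negP => /(weight_gt0 cu).
  by rewrite ltNge -(gap0_weight g0) cmax.
have : \sum_(d < m.+1) gap u d <= 0 by apply: sumr_le0 => d _; exact: le0.
by rewrite sum_gap; lra.
Qed.

(** Arc j + 1 is empty where u_j = 1, and arcs 0, ..., j are empty where u_j = 0. An arc of maximal
    weight is nonempty, which gives the boundary conditions of [coincidence]. *)
Lemma equal_weights m : exists2 u : 'rV[R]_m, unit_cube u &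
  forall c d : 'I_m.+1, weight c u = weight d u.
Proof.
apply: (@coincidence R m (fun c : 'I_m.+1 => weight c)).
- by move=> c; exact: weight_continuous.
- move=> u c j cu /(maximal_gap_gt0 cu) g0 uj; apply/eqP => cj.
  by move: g0; rewrite /gap cj tau_step uj mul1r subrr ltxx.
move=> u c j cu /(maximal_gap_gt0 cu) g0 uj; rewrite ltnNge; apply/negP => cj.
have tau0 k : (k <= j.+1)%N -> tau u k = 0.
  case: k => // k kj; rewrite /tau (bigD1 j) //= uj mul0r //.
by move: g0; rewrite /gap !tau0 ?subrr ?ltxx //; lia.
Qed.

(* A nearly full arc c would force the remaining ones into the neighbourhood of
   a, where the chord of c dominates that of an adjacent arc. *)
Lemma long_arc_chord m (u : 'rV[R]_m) (c d : 'I_m.+1) : unit_cube u ->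
  c != d -> 1 - e < gap u c -> exists2 d' : 'I_m.+1, c != d' &
  D (a + tau u d') (a + tau u d'.+1) <= D (a + tau u c) (a + tau u c.+1).
Proof.
move=> cu cd gc; have := e_gt0; have := e_lehalf => e1 e0.
have Dp x y : D (x - 1) y = D x y.
  by rewrite D_sym -D_periodic subrK D_sym.
have := tau_le1 c.+1 cu; have := tau_ge0 c cu; move: gc;
  rewrite /gap => gc t0 t1.
(* If the long arc is the first, arc 1 is the neighbour; it and the end of the long arc are moved
   back by one period, into (a - e, a]. *)
case: (posnP c) => [c0|cpos].
  have m1 : (1 < m.+1)%N by move: cd (ltn_ord d); rewrite -(inj_eq val_inj) /=;
    lia.
  exists (Ordinal m1); first by rewrite -(inj_eq val_inj) /= c0.
  have := gap_ge0 (Ordinal m1) cu; have := tau_le1 2 cu.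
  rewrite /gap /= c0 => t2 g1; rewrite c0 in gc t0 t1.
  have tau0 : tau u 0 = 0 by [].
  have -> :
    D (a + tau u 1) (a + tau u 2) = D (a + tau u 1 - 1) (a + tau u 2 - 1).
    by rewrite -[RHS]D_periodic subrK Dp.
  rewrite [leRHS]D_sym -[leRHS]Dp; apply: D_local; lra.
(* Otherwise the preceding arc lies in [a, a + e), and only the end of the long arc is moved
   back. *)
have cm : (c.-1 < m.+1)%N by have := ltn_ord c; lia.
exists (Ordinal cm); first by rewrite -(inj_eq val_inj) /=; lia.
rewrite /= prednK //.
have := gap_ge0 (Ordinal cm) cu; rewrite /gap prednK // => g1.
rewrite [leRHS]D_sym -[leRHS]Dp; have := tau_ge0 c.-1 cu => t'.
apply: D_local; lra.
Qed.

Lemma equal_arcs (m : nat) : exists t : nat -> R,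
  [/\ t 0%N = a, t m.+1 = a + 1, forall i, (i <= m)%N -> t i < t i.+1 &
    forall i j, (i <= m)%N -> (j <= m)%N ->
      D (t i) (t i.+1) = D (t j) (t j.+1)].
Proof.
have [u cu eqw] := equal_weights m.
have g0 (c : 'I_m.+1) : 0 < gap u c.
  by apply: maximal_gap_gt0 => // d; rewrite (eqw d c).
(* The second arc [d] rules out m = 0, where the only arc has length 1. If [c] were long, [d'] would
   be shorter than [e], hence free of penalty, and the weight of [c] would exceed that of [d']. *)
have short (c d : 'I_m.+1) : c != d -> gap u c <= 1 - e.
  move=> cd; rewrite leNgt; apply/negP => gc.
  have [d' cd' le] := long_arc_chord cu cd gc.
  have := eqw c d'; rewrite /weight.
  have /max_idPl -> : gap u d' - (1 - e) <= 0.
    by have := gap_le1 cu cd'; have := e_lehalf; lra.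
  have /max_idPr -> : 0 <= gap u c - (1 - e) by lra.
  lra.
exists (fun i => a + tau u i); split=> [||i im|i j im jm].
- by rewrite addr0.
- by rewrite tau_last.
- by have := g0 (Ordinal (im : i < m.+1)%N); rewrite /gap /=; lra.
pose c : 'I_m.+1 := Ordinal (im : i < m.+1)%N;
  pose d : 'I_m.+1 := Ordinal (jm : j < m.+1)%N.
have [/(congr1 val) /= -> //|cd] := eqVneq c d.
have := eqw c d; rewrite /weight.
have /max_idPl -> : gap u c - (1 - e) <= 0 by have := short _ _ cd; lra.
have dc : d != c by rewrite eq_sym.
have /max_idPl -> : gap u d - (1 - e) <= 0 by have := short _ _ dc; lra.
by rewrite !addr0.
Qed.
End EqualArcs.

(** * Knots *)

Lemma circle_expD1 (R : realType) (t : R) : circle_exp (t + 1) = circle_exp t.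
Proof.
apply: val_inj => /=;
  have -> : 2 * pi * (t + 1) = 2 * pi * t + pi *+ 2 :> R by ring.
by rewrite cosD2pi sinD2pi.
Qed.

(** The cosine of the angle difference is 1 - 2 sin(pi (t - s))^2, where 0 < pi (t - s) < pi. *)
Lemma circle_exp_inj (R : realType) (s t : R) :
  s < t < s + 1 -> circle_exp s <> circle_exp t.
Proof.
move=> /andP[st ts] /(congr1 val) [] ec es.
have c1 : cos (2 * pi * t - 2 * pi * s) = 1.
  by rewrite cosB ec es -!expr2 cos2Dsin2.
have pi0 := pi_gt0 R.
have : 0 < sin (pi * (t - s)).
  apply: sin_gt0_pi; rewrite mulr_gt0 ?subr_gt0 //=.
  by rewrite -[ltRHS]mulr1 ltr_pM2l //; lra.
move: c1; have -> : 2 * pi * t - 2 * pi * s = (pi * (t - s)) *+ 2 by ring.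
rewrite cos_mulr2n cos2sin2 => c1 s0.
have : 0 < sin (pi * (t - s)) ^+ 2 by rewrite exprn_gt0.
lra.
Qed.

Lemma circle_exp_surj (R : realType) (z : circle R) :
  exists t, circle_exp t = z.
Proof.
case: z => -[x y] xy.
have xy1 : x ^+ 2 + y ^+ 2 = 1.
  move: (xy); rewrite normc_def /= eq_complex /= eqxx andbT => /eqP h.
  have := congr1 (fun r => r ^+ 2) h; rewrite sqr_sqrtr ?expr1n //.
  by rewrite addr_ge0 ?sqr_ge0.
have x1 : -1 <= x <= 1.
  rewrite -ler_norml -sqrtr_sqr -[leRHS]sqrtr1 ler_sqrt // -xy1.
  by rewrite lerDl sqr_ge0.
have pi0 : (2 * pi : R) != 0 by rewrite mulf_neq0 ?gt_eqF ?pi_gt0.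
have sa : sin (acos x) = `|y|.
  by rewrite sin_acos // -sqrtr_sqr; congr Num.sqrt; lra.
have ca : cos (acos x) = x by rewrite acosK // in_itv.
have [y0|y0] := leP 0 y.
  exists (acos x / (2 * pi)); apply: val_inj; rewrite /= mulrC divfK //.
  by rewrite ca sa ger0_norm.
exists (- acos x / (2 * pi)); apply: val_inj; rewrite /= mulrC divfK //.
by rewrite cosN sinN ca sa ltr0_norm // opprK.
Qed.

(** * Chords of an immersed curve near a point *)

Definition sqdist (R : realType) (f : R -> 'rV[R]_3) (s t : R) : R :=
  \sum_(k < 3) (f s ord0 k - f t ord0 k) ^+ 2.

Lemma close_vectors_acute (R : realType) (eta : R) (k0 : 'I_3)
    (w alpha beta : 'I_3 -> R) :
  0 < eta -> 4 * eta <= `|w k0| ->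
  (forall k, `|alpha k - w k| <= eta) ->
  (forall k, `|beta k - w k| <= eta) ->
  0 <= \sum_(k < 3) alpha k * beta k.
Proof.
move=> eta0 wk0 ha hb.
(* At [k0] both factors have the same sign and size at least 3 eta, whence 9 = 11 - 2. Elsewhere the
   factors differ by at most 2 eta, so the product is at least - eta^2. The three bounds sum to (11
   - 6) eta^2. *)
have term k : (k == k0)%:R * (11 * eta ^+ 2) - 2 * eta ^+ 2 <= alpha k * beta k.
  have := ha k; have := hb k; rewrite !ler_norml => /andP[b1 b2] /andP[a1 a2].
  have [kk0|_] := eqVneq k k0; last first.
    rewrite mul0r sub0r.
    have : 0 <= (2 * eta - (alpha k - beta k)) * (2 * eta + (alpha k - beta k)).
      by apply: mulr_ge0; lra.
    have := sqr_ge0 (alpha k + beta k); have := sqr_ge0 eta; rewrite !expr2;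
      lra.
  rewrite -{}kk0 in wk0; set x := alpha k in a1 a2 *;
    set y := beta k in b1 b2 *.
  suff h : 9 * eta ^+ 2 <= x * y by rewrite mul1r; lra.
  move: wk0.
  have [w0|w0] := leP 0 (w k);
    [rewrite ger0_norm //|rewrite ltr0_norm //] => hw.
    have -> : 9 * eta ^+ 2 = (3 * eta) * (3 * eta) by ring.
    apply: ler_pM; lra.
  have -> : 9 * eta ^+ 2 = (3 * eta) * (3 * eta) by ring.
  rewrite -[leRHS]mulrNN; apply: ler_pM; lra.
apply: le_trans (ler_sum _ (fun k _ => term k)).
have one : \sum_(k < 3) (k == k0)%:R = 1 :> R.
  by rewrite (bigD1 k0) //= eqxx big1 ?addr0 // => k /negbTE ->.
rewrite big_split /= -mulr_suml one mul1r sumr_const card_ord -mulr_natl.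
have := exprn_gt0 2 eta0; lra.
Qed.

Section Immersion.
Variables (R : realType) (f : R -> 'rV[R]_3) (a : R).
Hypothesis f_derivable : forall t, derivable f t 1.
Hypothesis f'_derivable : derivable (f^`())%classic a 1.
Hypothesis f'_neq0 : (f^`())%classic a != 0.

Let w : 'rV[R]_3 := (f^`())%classic a.

Lemma coord_is_derive (k : 'I_3) (t : R) :
  is_derive t 1 (fun x : R => f x ord0 k) ((f^`())%classic t ord0 k).
Proof.
have ft := @f_derivable t; apply: DeriveDef.
  by move/derivable_mxP: ft; apply.
by rewrite derive1E derive_mx // mxE.
Qed.

Lemma coord_curve_continuous (k : 'I_3) : continuous (fun x : R => f x ord0 k).
Proof.
move=> t; apply/differentiable_continuous/derivable1_diffP.
by case: (coord_is_derive k t).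
Qed.

Lemma sqdist_continuous : continuous (fun z : R * R => sqdist f z.1 z.2).
Proof.
rewrite /sqdist => z.
apply: (@cvg_big R _ +%R 0 xpredT _ _ (nbhs z) _
  (fun k (z : R * R) => (f z.1 ord0 k - f z.2 ord0 k) ^+ 2)).
  by move=> x; apply: cvgD; [exact: cvg_fst|exact: cvg_snd].
move=> k _; rewrite expr2; under eq_cvg do rewrite expr2.
have ck :
  f x.1 ord0 k - f x.2 ord0 k @[x --> z] --> f z.1 ord0 k - f z.2 ord0 k.
  apply: cvgB.
    by apply: (cvg_comp (fun z : R * R => z.1) (fun x => f x ord0 k) cvg_fst);
      exact: coord_curve_continuous.
  by apply: (cvg_comp (fun z : R * R => z.2) (fun x => f x ord0 k) cvg_snd);
    exact: coord_curve_continuous.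
exact: cvgM.
Qed.

(** Near [a] the increments over [p, q], [q, r] and [r, s] are all close in direction to [w], so
    their inner products are nonnegative and adding the outer two to the middle one cannot shorten
    it. *)
Lemma chord_monotone : exists e, [/\ 0 < e, e <= 1 / 2 & forall p q r s,
  a - e < p -> p <= q -> q <= r -> r <= s -> s < a + e ->
  sqdist f q r <= sqdist f p s].
Proof.
have [k0 wk0] : exists k0, w ord0 k0 != 0.
  apply: contra_notP (negP f'_neq0) => h; apply/eqP/rowP => k; rewrite mxE.
  by apply/eqP/negP => hk; apply: h; exists k; apply/negP.
pose eta := `|w ord0 k0| / 4.
have eta0 : 0 < eta by rewrite divr_gt0 ?normr_gt0.
have : \forall t \near a, forall k, `|(f^`())%classic t ord0 k - w ord0 k| <= eta.
  apply: (@filter_forall R _ _ (nbhs a) (nbhs_filter a)) => k.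
  have : {for a, continuous (fun t => (f^`())%classic t ord0 k)}.
    apply/differentiable_continuous/derivable1_diffP.
    by move/derivable_mxP: f'_derivable; apply.
  by move/cvgr_distC_le; apply.
move=> /nbhs_ballP[e0 /= e0_gt0 ball_e0].
exists (Num.min e0 (1 / 2)); split.
- by rewrite lt_min e0_gt0 /=; lra.
- by rewrite ge_min lexx orbT.
move=> p q r s ap pq qr rs sa.
(* The mean value theorem is applied to each coordinate separately: the intermediate points may
   differ, but each entry stays close to that of [w]. *)
have incr x y : a - e0 < x -> x <= y -> y < a + e0 -> exists alpha : 'I_3 -> R,
    (forall k, `|alpha k - w ord0 k| <= eta) /\
    (forall k, f y ord0 k - f x ord0 k = alpha k * (y - x)).
  move=> ax xy ya.
  suff /choice[alpha Ha] : forall k, exists c, `|c - w ord0 k| <= eta /\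
      f y ord0 k - f x ord0 k = c * (y - x).
    by exists alpha; split=> k; case: (Ha k).
  move=> k; have [c cxy E] := MVT_segment xy (fun t _ => coord_is_derive k t)
    (continuous_subspaceT (@coord_curve_continuous k)).
  exists ((f^`())%classic c ord0 k); split=> //; apply: ball_e0.
  by move: cxy; rewrite in_itv /= => /andP[xc cy]; rewrite /ball /= ltr_norml;
    apply/andP; split; lra.
have e_le : Num.min e0 (1 / 2) <= e0 by rewrite ge_min lexx.
have [||| al [al_w alE]] := incr p q; try lra.
have [||| be [be_w beE]] := incr q r; try lra.
have [||| ga [ga_w gaE]] := incr r s; try lra.
have eta4 : 4 * eta <= `|w ord0 k0| by rewrite /eta; lra.
have ab := close_vectors_acute (w := fun k => w ord0 k) eta0 eta4 al_w be_w.
have bg := close_vectors_acute (w := fun k => w ord0 k) eta0 eta4 be_w ga_w.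
have ag := close_vectors_acute (w := fun k => w ord0 k) eta0 eta4 al_w ga_w.
rewrite /sqdist -subr_ge0 -sumrB.
(* The cross terms; beyond [2 * T], the difference consists of the squares of the two outer
   increments. *)
pose T := (q - p) * (r - q) * \sum_(k < 3) al k * be k +
  (r - q) * (s - r) * \sum_(k < 3) be k * ga k +
  (q - p) * (s - r) * \sum_(k < 3) al k * ga k.
have T0 : 0 <= 2 * T.
  by rewrite mulr_ge0 // !addr_ge0 // !mulr_ge0 // subr_ge0.
apply: le_trans T0 _; rewrite /T !mulr_sumr -!big_split /= mulr_sumr.
apply: ler_sum => k _.
have -> : f q ord0 k - f r ord0 k = - (be k * (r - q)) by rewrite -beE opprB.
have -> : f p ord0 k - f s ord0 k =
    - (al k * (q - p) + be k * (r - q) + ga k * (s - r)).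
  by rewrite -alE -beE -gaE; ring.
have := sqr_ge0 (al k * (q - p)); have := sqr_ge0 (ga k * (s - r)).
rewrite !expr2; lra.
Qed.

End Immersion.

(** * Inscribed polygons from equal chords *)

Lemma enorm_sqdist (R : realType) (f : R -> 'rV[R]_3) (s t : R) :
  enorm (f s - f t) = Num.sqrt (sqdist f s t).
Proof. by congr Num.sqrt; apply: eq_bigr => k _; rewrite !mxE. Qed.

Theorem theorem1 (R : realType) (K : circle R -> 'rV[R]_3)
    (hK : smooth_knot K) (x0 : 'rV[R]_3) (hx0 : range K x0)
    (n : nat) (hn : (0 < n)%N) :
  exists x : 'I_n -> 'rV[R]_3,
    regular_gon_inscribing K x /\ exists i : 'I_n, x i = x0.
Proof.
case: n hn => // m _; case: hx0 => z _ <-.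
have [a <-] := circle_exp_surj z.
case: hK => smooth immersion injK; pose f := K \o @circle_exp R.
have f_periodic t : f (t + 1) = f t by rewrite /f /= circle_expD1.
have f_inj s t : s < t < s + 1 -> f s <> f t.
  by move=> /circle_exp_inj st /injK.
have f_derivable t : derivable f t 1 by exact: (smooth 0%N t).
have [e [e0 e1 local]] :=
  chord_monotone f_derivable (smooth 1%N a) (immersion a).
have d0 s t : 0 <= sqdist f s t by apply: sumr_ge0 => k _; exact: sqr_ge0.
have [|s t st|s t|s t|t [t_first t_last t_incr t_eq]] :=
    @equal_arcs R (sqdist f) a e
      (sqdist_continuous f_derivable) _ d0 _ _ _ e0 e1 local m.
- by move=> s; rewrite /sqdist big1 // => k _; rewrite subrr expr0n.
- rewrite lt_def d0 andbT; apply/eqP => /psumr_eq0P eq0; apply: (f_inj _ _ st).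
  apply/rowP => k; apply/eqP; rewrite -subr_eq0 -sqrf_eq0; apply/eqP.
  by apply: eq0 => // i _; exact: sqr_ge0.
- by apply: eq_bigr => k _; rewrite -[in LHS]opprB sqrrN.
- by rewrite /sqdist f_periodic.
have t_mono i j : (i < j)%N -> (j <= m.+1)%N -> t i < t j.
  elim: j => // j IH; rewrite ltnS leq_eqVlt => /predU1P[->|ij] jm.
    exact: t_incr.
  by apply: lt_trans (t_incr j jm); apply: IH => //; exact: ltnW.
exists (fun i => f (t i)); split; last first.
  by exists ord0; rewrite t_first.
split.
- move=> i j; wlog ij : i j / (i < j)%N.
    move=> H fij; have [lt|lt|/val_inj //] := ltngtP i j; first exact: H.
    by apply/esym/H.
  move=> fij; case: (f_inj (t i) (t j)) => //.
  rewrite t_mono //= ?[(j <= _)%N]ltnW //.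
  (* Both parameters lie in [a, a + 1), hence less than a period apart. *)
  apply: (@lt_le_trans _ _ (t m.+1)); first by rewrite t_mono.
  rewrite t_last lerD2r -t_first; case: (posnP i) => [->//|i0].
  by rewrite ltW // t_mono // ltnW.
- exists t; split => [i j /andP[ij jm]||i] //.
  + by rewrite t_mono // ltnW.
  + by rewrite t_first -t_last t_incr.
suff H (i : 'I_m.+1) : enorm (f (t i) - f (t (ordS i))) =
    Num.sqrt (sqdist f (t 0%N) (t 1%N)) by move=> i j; rewrite !H.
have im := ltn_ord i.
(* For i = m the successor wraps to [t 0 = a], which has the same image as [t m.+1 = a + 1]. *)
have -> : f (t (ordS i)) = f (t i.+1).
  rewrite /=; have [/eqP e_im|ne] := eqVneq (i.+1) m.+1.
    by rewrite (eqP e_im) modnn t_first t_last f_periodic.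
  by rewrite modn_small //; lia.
by rewrite enorm_sqdist (t_eq i 0%N).
Qed.
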